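(* Fix $\sigma>0$. Consider a sequence of problems indexed by $(k,n,p)$ with $p\to\infty$, $k/p\to0$ and $(k\log p)/n\to0$, with random designs $X\in\mathbb{R}^{n\times p}$ having i.i.d. $\mathcal{N}(0,1/n)$ entries. Then for any $\epsilon>0$, $$\inf_{\hat\beta}\ \sup_{\|\beta\|_0\le k}\mathbb{P}\left(\frac{\|\hat\beta-\beta\|^2}{2\sigma^2k\log(p/k)}>1-\epsilon\right)\longrightarrow1,$$ where the infimum is over all estimators $\hat\beta$ (measurable functions of $(X,y)$).
   Context: $k,n,p$ are positive integers. We observe $(X,y)$ with $y=X\beta+z$, where $\beta\in\mathbb{R}^p$ is unknown and $z\sim\mathcal{N}(0,\sigma^2I_n)$ is independent of $X$. $\|\beta\|_0$ is the number of nonzero entries of $\beta$ and $\|\cdot\|$ is the Euclidean norm. The supremum is over all $\beta\in\mathbb{R}^p$ with at most $k$ nonzero entries. *)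

(* Defs.v *)
From HB Require Import structures.
From mathcomp Require Import all_boot all_order all_algebra.
From mathcomp Require Import all_classical all_reals all_analysis.

Set Implicit Arguments.
Unset Strict Implicit.
Unset Printing Implicit Defensive.

Import Order.TTheory GRing.Theory Num.Theory.
Import numFieldNormedType.Exports.

Local Open Scope classical_set_scope.
Local Open Scope ring_scope.

Definition measure_matrix_display : measure_display -> measure_display.
Proof. exact. Qed.

(* Matrices carry the sigma-algebra generated by their entries, as tuples do
   in the library; on real matrices this is the Borel sigma-algebra. *)
Section measurable_matrix.
Context {d} {T : measurableType d} {m n : nat}.

Definition measurable_matrix : set (set 'M[T]_(m, n)) :=
  <<s \bigcup_(ij : 'I_m * 'I_n)
        preimage_set_system setT (fun A : 'M[T]_(m, n) => A ij.1 ij.2)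
          measurable >>.

Let matrix_set0 : measurable_matrix set0.
Proof. exact: sigma_algebra0. Qed.

Let matrix_setC A : measurable_matrix A -> measurable_matrix (~` A).
Proof. exact: sigma_algebraC. Qed.

Let matrix_bigcup (F : (set 'M[T]_(m, n))^nat) :
  (forall i, measurable_matrix (F i)) -> measurable_matrix (\bigcup_i F i).
Proof. exact: sigma_algebra_bigcup. Qed.

HB.instance Definition _ :=
  @isMeasurable.Build (measure_matrix_display d) 'M[T]_(m, n)
    measurable_matrix matrix_set0 matrix_setC matrix_bigcup.

End measurable_matrix.

(* The library norm `|v| on matrices is the sup norm, not this one. *)
Definition l2norm {R : rcfType} {p : nat} (v : 'cV[R]_p) : R :=
  Num.sqrt (\sum_i v i 0 ^+ 2).

Definition l0norm {R : nmodType} {p : nat} (v : 'cV[R]_p) : nat :=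
  #|[pred i | v i 0 != 0]|.

Definition has_law {d d'} {T : measurableType d} {T' : measurableType d'}
    {R : realType} (P : probability T R) (Y : T -> T')
    (mu : set T' -> \bar R) : Prop :=
  forall A, measurable A -> P (Y @^-1` A) = mu A.

Definition independent2 {d d1 d2} {T : measurableType d}
    {T1 : measurableType d1} {T2 : measurableType d2} {R : realType}
    (P : probability T R) (Y1 : T -> T1) (Y2 : T -> T2) : Prop :=
  forall A B, measurable A -> measurable B ->
    P (Y1 @^-1` A `&` Y2 @^-1` B) = (P (Y1 @^-1` A) * P (Y2 @^-1` B))%E.

(* The index type is finite, so the product rule for subfamilies is the case
   where some of the B i are setT. *)
Definition mutually_independent {d d'} {T : measurableType d}
    {T' : measurableType d'} {R : realType} {I : finType}
    (P : probability T R) (Y : I -> T -> T') : Prop :=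
  forall B : I -> set T', (forall i, measurable (B i)) ->
    P (\bigcap_i (Y i @^-1` B i)) = (\prod_i P (Y i @^-1` B i))%E.

Definition iid {d d'} {T : measurableType d} {T' : measurableType d'}
    {R : realType} {I : finType} (P : probability T R) (Y : I -> T -> T')
    (mu : set T' -> \bar R) : Prop :=
  mutually_independent P Y /\ forall i, has_law P (Y i) mu.

(* Main.v *)
Require Import Defs.
From HB Require Import structures.
From mathcomp Require Import all_boot all_order all_algebra.
From mathcomp Require Import all_classical all_reals all_analysis.
From mathcomp Require Import measurable_realfun ring lra.

Import Order.TTheory GRing.Theory Num.Theory.
Import numFieldNormedType.Exports.

Local Open Scope classical_set_scope.
Local Open Scope ring_scope.

(** The supremum over sparse vectors dominates the average over a prior.  Cut
    [k * q] of the coordinates into [k] blocks of length [q = p %/ k], and put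
    in each block one spike, at a uniform position, of height [tau] with
    [tau ^+ 2 = (1 - delta) * 2 * sigma ^+ 2 * ln q].  As [ln q] is equivalent
    to [ln (p / k)], it is enough to show that any estimator loses nearly
    [tau ^+ 2] in nearly every block.

    A vector can be at squared distance less than [(1 - delta) * tau ^+ 2] from
    at most [delta^-1] of the [q] possible spikes of a block
    ([near_spikes_card]).  An estimator of low loss thus provides, in a fraction
    [delta] of the blocks, a list of at most [delta^-1] positions that contains
    the true one, and Markov's inequality leaves a question about one block:
    how likely is the true position to be in such a list?

    Compare with the model where the block carries no spike.  There the data
    say nothing about the position, and the answer is at most [delta^-1 / q].
    Adding the spike [h] changes the law of the data by a likelihood ratio [L]
    whose logarithm, given the design, is normal with mean and half variance
    [|X h|^2 / (2 sigma^2)] under the model with the spike.  The bound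
    [L <= e^l + L^(1+s) e^(-s l)] gives [P_h(A) <= e^l P_0(A) + e^(-s l) E L^(1+s)]
    ([gaussian_shift_le], [model_shift_le]), and the last expectation is an
    explicit Gaussian integral over the design ([exp_sqr_column]).  Because
    [ln q] is negligible against [n], the squared norm of a column of the design
    behaves like the constant one, so that [ln L] is about [(1 - delta) * ln q].
    With [l] strictly between [(1 - delta) * ln q] and [ln q], both the error and
    [e^l / q] are negative powers of [q] ([decoded_prob_le],
    [exists_hard_spikes]).  Finally [q] tends to infinity with [p / k]. *)

(** * Integration against independent variables *)

Section transfer.
Local Open Scope ereal_scope.
Context {d d'} {T : measurableType d} {T' : measurableType d'} {R : realType}.
Variables (m : {measure set T -> \bar R}) (mu : {measure set T' -> \bar R}).
Variables (W : T -> R) (Y : T -> T') (c : R).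
Hypotheses (mW : measurable_fun setT W) (W0 : forall x, (0 <= W x)%R).
Hypothesis mY : measurable_fun setT Y.
Hypothesis indicWE : forall B, measurable B ->
  \int[m]_x ((W x)%:E * (\1_B (Y x))%:E) = c%:E * mu B.

Import HBNNSimple.

(** An identity known for indicators extends to nonnegative functions by
    monotone convergence along simple functions.  With [Y] the identity and
    [c = 1] it says how to integrate against a measure given by its density
    [W]; with [W] a product of functions of variables independent of [Y] it is
    the induction step of the product rule for expectations. *)
Lemma weighted_ge0_integral (f : T' -> \bar R) :
  measurable_fun setT f -> (forall y, 0 <= f y) ->
  \int[m]_x ((W x)%:E * f (Y x)) = c%:E * \int[mu]_y f y.
Proof.
have mW' : measurable_fun setT (fun x => (W x)%:E) by exact/measurable_EFinP.
move=> mf f0; pose f_ := nnsfun_approx measurableT mf.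
have mfY n : measurable_fun setT (fun x => (f_ n (Y x))%:E).
  by apply/measurable_EFinP; apply: (measurableT_comp (f := f_ n)).
(* For a simple function the claim is linearity over its finitely many values. *)
have step n : \int[m]_x ((W x)%:E * (f_ n (Y x))%:E) = c%:E * \int[mu]_y (f_ n y)%:E.
  transitivity (\int[m]_x (\sum_(r \in range (f_ n))
      (W x)%:E * (r%:E * (\1_(f_ n @^-1` [set r]) (Y x))%:E))).
    apply: eq_integral => x _.
    rewrite fimfunE -fsumEFin// ge0_mule_fsumr// => r.
    exact: nnfun_muleindic_ge0.
  have mind r : measurable_fun [set: T]
      (fun x => (\1_(f_ n @^-1` [set r]) (Y x) : R)%:E).
    apply/measurable_EFinP; apply: measurableT_comp => //.
  rewrite ge0_integral_fsum//; last 2 first.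
  - move=> r; apply: emeasurable_funM => //.
    exact: emeasurable_funM.
  - by move=> r x _; apply: mule_ge0; [rewrite lee_fin|exact: nnfun_muleindic_ge0].
  rewrite integralT_nnsfun sintegralE ge0_mule_fsumr; last first.
    move=> r; have [r0|r0] := leP 0%R r; first by rewrite mule_ge0.
    by rewrite preimage_nnfun0// measure0 mule0.
  apply: eq_fsbigr => r _.
  have [r0|r0] := leP 0%R r; last first.
    rewrite preimage_nnfun0// measure0 !mule0; apply: integral0_eq => x _.
    by rewrite indic0 !mule0.
  under eq_integral do rewrite muleCA.
  rewrite ge0_integralZl//; first by rewrite indicWE// muleCA.
  - exact: emeasurable_funM.
  - by move=> x _; rewrite mule_ge0// lee_fin.
have cvgf y : (f_ n y)%:E @[n --> \oo] --> f y by exact: cvg_nnsfun_approx.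
have ndf y : {homo (fun n => (f_ n y)%:E) : a b / (a <= b)%N >-> a <= b}.
  by move=> a b ab; rewrite lee_fin; exact/lefP/nd_nnsfun_approx.
have lhs : (\int[m]_x ((W x)%:E * (f_ n (Y x))%:E)) @[n --> \oo] -->
    \int[m]_x ((W x)%:E * f (Y x)).
  have -> : \int[m]_x ((W x)%:E * f (Y x)) =
      \int[m]_x (limn (fun n => (W x)%:E * (f_ n (Y x))%:E)).
    by apply: eq_integral => x _; apply/esym/cvg_lim => //; exact: cvgeZl.
  apply: cvg_monotone_convergence => //.
  - by move=> n; exact: emeasurable_funM.
  - by move=> n x _; rewrite mule_ge0// lee_fin.
  - by move=> x _ a b ab; apply: lee_wpmul2l; [rewrite lee_fin|exact: ndf].
have rhs : (\int[mu]_y (f_ n y)%:E) @[n --> \oo] --> \int[mu]_y f y.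
  have -> : \int[mu]_y f y = \int[mu]_y (limn (fun n => (f_ n y)%:E)).
    by apply: eq_integral => y _; apply/esym/cvg_lim.
  apply: cvg_monotone_convergence => //.
  - by move=> n; exact/measurable_EFinP.
  - by move=> n y _; rewrite lee_fin.
have /cvg_lim lim_rhs : (c%:E * \int[mu]_y (f_ n y)%:E) @[n --> \oo] -->
  c%:E * \int[mu]_y f y by exact: cvgeZl.
have lim_lhs := cvg_lim (@ereal_hausdorff R) lhs.
by rewrite -(lim_rhs (@ereal_hausdorff R)) -lim_lhs; under eq_fun do rewrite step.
Qed.
End transfer.

Section indep.
Context {d d'} {T : measurableType d} {T' : measurableType d'} {R : realType}.
Context {I : finType}.
Variables (P : probability T R) (Y : I -> T -> T').
Variables (mu : {measure set T' -> \bar R}).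
Hypotheses (mY : forall i, measurable_fun setT (Y i)) (iidY : iid P Y mu).

(** Independence is the case where every [f i] is an indicator.  The indicators
    are traded for general functions one index at a time: once all factors but
    the [i]-th are frozen, both sides are, up to a constant, the same measure
    evaluated on the set in position [i], and [weighted_ge0_integral] applies. *)
Lemma iid_integral_prod (f : I -> T' -> R) (g : I -> R) :
  (forall i, measurable_fun setT (f i)) -> (forall i y, 0 <= f i y) ->
  (forall i, \int[mu]_y (f i y)%:E = (g i)%:E)%E ->
  (\int[P]_w (\prod_i f i (Y i w))%:E = (\prod_i g i)%:E)%E.
Proof.
(* [s] lists the indices whose function is already arbitrary. *)
suff H (s : seq I) : forall (f : I -> T' -> R) (g : I -> R),
  (forall i, i \notin s -> exists B, measurable B /\ f i = \1_B) ->
  (forall i, measurable_fun setT (f i)) -> (forall i y, 0 <= f i y) ->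
  (forall i, \int[mu]_y (f i y)%:E = (g i)%:E)%E ->
  (\int[P]_w (\prod_i f i (Y i w))%:E = (\prod_i g i)%:E)%E.
  by apply: (H (index_enum I)) => i; rewrite mem_index_enum.
have [indY lawY] := iidY.
elim: s => [|i s IH] {}f {}g fE mf f0 fg.
  have [B HB] : {B : I -> set T' &
      forall i, measurable (B i) /\ f i = \1_(B i)}.
    by apply: (@choice _ _ (fun i B => measurable B /\ f i = \1_B)) => i; exact: fE.
  have mB i : measurable (Y i @^-1` B i).
    by rewrite -[_ @^-1` _]setTI; apply: mY => //; exact: (HB i).1.
  transitivity (\int[P]_w (\1_(\bigcap_i (Y i @^-1` B i)) w)%:E)%E.
    apply: eq_integral => w _; congr EFin.
    rewrite indicE; have [Bw|/existsNP[i nB]] := pselect (forall i, B i (Y i w)).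
      rewrite mem_set; last by move=> i _; exact: Bw.
      by rewrite big1// => i _; rewrite (HB i).2 indicE mem_set//; exact: Bw.
    rewrite memNset; last by move=> Bw; exact/nB/Bw.
    by rewrite (bigD1 i)//= (HB i).2 indicE memNset// mul0r.
  rewrite integral_indic// ?setIT; last first.
    by apply: fin_bigcap_measurable => // i _; exact: mB.
  transitivity (\prod_i P (Y i @^-1` B i))%E.
    by apply: indY => i; exact: (HB i).1.
  elim/big_ind2 : _ => // [_ x _ y -> ->|i _]; first by rewrite EFinM.
  rewrite lawY ?(HB i).1//; last exact: (HB i).1.
  by rewrite -fg (HB i).2 integral_indic ?setIT//; exact: (HB i).1.
have g0 j : 0 <= g j.
  by rewrite -lee_fin -fg; apply: integral_ge0 => y _; rewrite lee_fin.
under eq_integral do rewrite (bigD1 i)//= mulrC EFinM.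
rewrite [in RHS](bigD1 i)//= mulrC EFinM -fg.
apply: (@weighted_ge0_integral _ _ _ _ _ P mu
   (fun w => \prod_(j | j != i) f j (Y j w)) (Y i) (\prod_(j | j != i) g j) _ _ _ _
   (fun y => (f i y)%:E)).
- under eq_fun do rewrite -big_filter.
  apply: measurable_prod => j _; exact: measurableT_comp.
- by move=> w; apply: prodr_ge0.
- exact: mY.
- move=> B mB.
  have muB : mu B \is a fin_num.
    rewrite -(lawY i)//; apply: fin_num_measure.
    by rewrite -[_ @^-1` _]setTI; exact: mY.
  pose f' j := if j == i then \1_B else f j.
  pose g' j := if j == i then fine (mu B) else g j.
  have Eg : \prod_(j | j != i) g j = \prod_(j | j != i) g' j.
    by apply: eq_bigr => j ji; rewrite /g' (negbTE ji).
  transitivity (\prod_j g' j)%:E; last first.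
    by rewrite (bigD1 i)//= {1}/g' eqxx EFinM fineK// muleC Eg.
  rewrite -(IH f' g').
  + apply: eq_integral => w _.
    rewrite -EFinM [in RHS](bigD1 i)//= /f' eqxx mulrC; congr (_ * _)%:E.
    by apply: eq_bigr => j ji; rewrite (negbTE ji).
  + move=> j js; rewrite /f'; have [ji|ji] := eqVneq j i; first by exists B.
    by apply: fE; rewrite inE negb_or ji.
  + by move=> j; rewrite /f'; case: ifPn.
  + by move=> j y; rewrite /f'; case: ifPn.
  + move=> j; rewrite /f' /g'; case: ifPn => // _.
    by rewrite integral_indic// setIT fineK.
- exact/measurable_EFinP.
- by move=> y; rewrite lee_fin.
Qed.
End indep.

(** * One-dimensional normal laws *)

Section gaussian1.
Context {R : realType}.
Local Notation lambda := (@lebesgue_measure R).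

Lemma integral_lebesgue_shift (a : R) (f : R -> \bar R) :
  measurable_fun setT f -> (forall x, 0 <= f x)%E ->
  (\int[lambda]_x f (x + a)%R = \int[lambda]_x f x)%E.
Proof.
move=> mf f0.
pose shift : measurableTypeR R -> measurableTypeR R := fun x : R => (x + a)%R.
have mshift : measurable_fun setT shift by exact: measurable_funD.
pose phi : {mfun measurableTypeR R >-> measurableTypeR R} :=
  HB.pack shift (isMeasurableFun.Build _ _ _ _ _ mshift).
transitivity (\int[pushforward lambda phi]_y f y)%E.
  by rewrite ge0_integral_pushforward.
apply: eq_measure_integral => //= A mA _.
apply/esym/lebesgue_measure_unique => //= _ [[b c]] _ <-.
rewrite /pushforward (_ : phi @^-1` `]b, c] = `]b - a, c - a]%classic).
  rewrite !lebesgue_measure_itv/= !lte_fin ltrD2r; case: ifP => // _.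
  by rewrite -!EFinB; congr EFin; ring.
by apply/seteqP; split => x /=; rewrite !in_itv/= ltrBlDr lerBrDr.
Qed.

Lemma integral_normal_prob_pdf (s : R) (f : R -> \bar R) :
  measurable_fun setT f -> (forall x, 0 <= f x)%E ->
  (\int[normal_prob 0%R s]_x f x =
   \int[lambda]_x ((normal_pdf 0%R s x)%:E * f x))%E.
Proof.
move=> mf f0; rewrite -[LHS]mul1e; apply/esym.
apply: (@weighted_ge0_integral _ _ _ _ _
  lambda (normal_prob 0 s) (normal_pdf 0 s) id) => //.
- exact: measurable_normal_pdf.
- by move=> x; exact: normal_pdf_ge0.
- move=> B mB; rewrite mul1e /normal_prob [RHS]integral_mkcond.
  by apply: eq_integral => x _; rewrite epatch_indic.
Qed.

Lemma normal_pdf_shift (s a x : R) : s != 0 ->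
  normal_pdf 0 s x * expR (a * x / s ^+ 2 - a ^+ 2 / (2 * s ^+ 2)) =
  normal_pdf 0 s (x - a).
Proof.
move=> s0; rewrite !normal_pdfE//= -[LHS]mulrA; congr (_ * _).
rewrite /normal_fun -expRD; congr expR; rewrite -mulr_natl.
by field; rewrite s0.
Qed.

(** The Cameron-Martin formula on the line: reweighting a centred normal law by
    the likelihood ratio of the shift [a] translates it by [a]. *)
Lemma normal_prob_shift (s a : R) (f : R -> \bar R) : s != 0 ->
  measurable_fun setT f -> (forall x, 0 <= f x)%E ->
  (\int[normal_prob 0%R s]_x
     (f x * (expR (a * x / s ^+ 2 - a ^+ 2 / (2 * s ^+ 2)))%:E) =
  \int[normal_prob 0%R s]_x f (x + a)%R)%E.
Proof.
move=> s0 mf f0.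
have mexp : measurable_fun setT
   (fun x : R => expR (a * x / s ^+ 2 - a ^+ 2 / (2 * s ^+ 2))).
  apply: measurableT_comp => //; apply: measurable_funB => //.
  by apply: measurable_funM => //; exact: measurable_funM.
rewrite !integral_normal_prob_pdf//.
- rewrite -[LHS](integral_lebesgue_shift a); first last.
  + move=> x; rewrite !mule_ge0// lee_fin ?normal_pdf_ge0// expR_ge0//.
  + apply: emeasurable_funM; first by apply/measurable_EFinP; exact: measurable_normal_pdf.
    by apply: emeasurable_funM => //; exact/measurable_EFinP.
  apply: eq_integral => x _.
  by rewrite muleCA -EFinM normal_pdf_shift// addrK muleC.
- apply: (measurableT_comp (f := f)) => //; exact: measurable_funD.
- apply: emeasurable_funM => //; exact/measurable_EFinP.
- by move=> x; rewrite mule_ge0// lee_fin expR_ge0.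
Qed.

(** The integrand is, up to normalization, a centred normal density of variance
    [s ^+ 2 / (1 - 2 * c * s ^+ 2)]; the ratio of the two normalizing constants
    is the value. *)
Lemma normal_prob_exp_sqr (s c : R) : 0 < s -> 2 * c * s ^+ 2 < 1 ->
  (\int[normal_prob 0%R s]_x (expR (c * x ^+ 2))%:E =
   (Num.sqrt (1 - 2 * c * s ^+ 2)^-1)%:E)%E.
Proof.
move=> s0 c1.
have v0 : 0 < 1 - 2 * c * s ^+ 2 by rewrite subr_gt0.
have cE : c = (1 - (1 - 2 * c * s ^+ 2)) / (2 * s ^+ 2).
  by field; rewrite gt_eqF.
set v := 1 - 2 * c * s ^+ 2 in v0 cE *; pose s' := s * Num.sqrt v^-1.
have s'0 : 0 < s' by rewrite mulr_gt0// sqrtr_gt0 invr_gt0.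
have s'2 : s' ^+ 2 = s ^+ 2 / v.
  by rewrite exprMn sqr_sqrtr// invr_ge0; exact: ltW.
rewrite integral_normal_prob_pdf//; last first.
  apply/measurable_EFinP; apply: measurableT_comp => //.
  by apply: measurable_funM => //; exact: measurable_funX.
rewrite -[RHS]mule1 -(integral_normal_pdf 0 s') -ge0_integralZl//=; last 2 first.
- by apply/measurable_EFinP; exact: measurable_normal_pdf.
- by move=> x _; rewrite lee_fin normal_pdf_ge0.
apply: eq_integral => x _; rewrite -!EFinM; congr EFin.
rewrite !normal_pdfE ?gt_eqF//= [RHS]mulrA -[LHS]mulrA.
have -> : normal_fun 0 s x * expR (c * x ^+ 2) = normal_fun 0 s' x.
  rewrite /normal_fun s'2 -expRD; congr expR.
  rewrite !subr0 !mulr2n cE; clearbody v.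
  by field; rewrite -mulr2n mulrn_eq0 sqrf_eq0 !gt_eqF.
congr (_ * _); rewrite /normal_peak s'2.
have -> : s ^+ 2 / v * pi *+ 2 = v^-1 * (s ^+ 2 * pi *+ 2) by rewrite !mulr2n; ring.
rewrite sqrtrM ?invr_ge0 ?ltW// invfM mulrA divff ?mul1r//.
by rewrite gt_eqF// sqrtr_gt0 invr_gt0.
Qed.

End gaussian1.

(** * Measures on matrices *)

Section measurable_matrix_theory.
Context {d} {T : measurableType d} {m n : nat}.

Lemma measurable_mx_entry (i : 'I_m) (j : 'I_n) :
  measurable_fun setT (fun A : 'M[T]_(m, n) => A i j).
Proof.
move=> _ B mB; rewrite setTI; apply: sub_sigma_algebra.
by exists (i, j) => //=; exists B => //; rewrite setTI.
Qed.

Lemma measurable_fun_mx {d'} {S : measurableType d'} (f : S -> 'M[T]_(m, n)) :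
  (forall i j, measurable_fun setT (fun w => f w i j)) -> measurable_fun setT f.
Proof.
move=> mf; apply: (measurability (\bigcup_(ij : 'I_m * 'I_n)
  preimage_set_system setT (fun A : 'M[T]_(m, n) => A ij.1 ij.2) measurable)) => //.
move=> _ [_ [[i j] _ [B mB <-]] <-]; rewrite setTI.
by have := mf i j measurableT B mB; rewrite !setTI.
Qed.

Definition mx_rect (B : 'I_m -> 'I_n -> set T) : set 'M[T]_(m, n) :=
  [set A | forall i j, B i j (A i j)].

(** The product sets form a pi-system, unlike the one-entry cylinders that
    generate the sigma-algebra of matrices by definition. *)
Definition mx_rects : set (set 'M[T]_(m, n)) :=
  [set A | exists B, (forall i j, measurable (B i j)) /\ A = mx_rect B].

Lemma measurable_mx_rect B : (forall i j, measurable (B i j)) ->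
  measurable (mx_rect B).
Proof.
move=> mB.
have -> : mx_rect B = \bigcap_(ij in [set: 'I_m * 'I_n])
    (fun A : 'M[T]_(m, n) => A ij.1 ij.2) @^-1` B ij.1 ij.2.
  by apply/seteqP; split => A /= BA => [[i j] _|i j]; [exact: BA|exact: (BA (i, j))].
apply: fin_bigcap_measurable => // -[i j] _.
by rewrite -[_ @^-1` _]setTI; apply: measurable_mx_entry.
Qed.

Lemma mx_rects_setI : setI_closed mx_rects.
Proof.
move=> _ _ [B [mB ->]] [C [mC ->]]; exists (fun i j => B i j `&` C i j); split.
  by move=> i j; exact: measurableI.
apply/seteqP; split => A /=; first by case=> BA CA i j; split.
by move=> BC; split => i j; have [] := BC i j.
Qed.

Lemma mx_rects_setT : mx_rects setT.
Proof.
by exists (fun _ _ => setT); split => //; apply/seteqP; split.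
Qed.

Lemma measurable_mxE :
  @measurable _ 'M[T]_(m, n) = <<s mx_rects >>.
Proof.
apply/seteqP; split.
  apply: smallest_sub; first exact: smallest_sigma_algebra.
  move=> _ [[i j] _ [B mB <-]]; apply: sub_sigma_algebra; rewrite setTI.
  exists (fun i' j' => if (i' == i) && (j' == j) then B else setT); split.
    by move=> i' j'; case: ifP.
  apply/seteqP; split => A /=; last by move=> /(_ i j); rewrite !eqxx.
  by move=> BA i' j'; case: ifP => // /andP[/eqP-> /eqP->].
apply: smallest_sub; first exact: sigma_algebra_measurable.
by move=> _ [B [mB ->]]; exact: measurable_mx_rect.
Qed.

Lemma mx_measure_unique {R : realType} (m1 m2 : {measure set 'M[T]_(m, n) -> \bar R}) :
  (m1 setT < +oo)%E ->
  (forall B, (forall i j, measurable (B i j)) -> m1 (mx_rect B) = m2 (mx_rect B)) ->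
  forall A, measurable A -> m1 A = m2 A.
Proof.
move=> m1oo m12; apply: (measure_unique mx_rects (fun=> setT)) => //.
- exact: measurable_mxE.
- exact: mx_rects_setI.
- by move=> _; exact: mx_rects_setT.
- by rewrite bigcup_const//; exists 0%N.
- by move=> _ [B [mB ->]]; exact: m12.
Qed.

End measurable_matrix_theory.

Section density.
Context {d} {T : measurableType d} {R : realType}.
Variables (m : {measure set T -> \bar R}) (g : T -> R).
Hypotheses (mg : measurable_fun setT g) (g0 : forall x, 0 <= g x).

(** The measurability and positivity of [g] are arguments so that the measure
    structure below can be inferred from the term. *)
Definition density of measurable_fun setT g & (forall x, 0 <= g x) :=
  fun A : set T => (\int[m]_(x in A) (g x)%:E)%E.
Local Notation nu := (density mg g0).

Let nu0 : nu set0 = 0%E. Proof. exact: integral_set0. Qed.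

Let nu_ge0 A : (0 <= nu A)%E.
Proof. by apply: integral_ge0 => x _; rewrite lee_fin. Qed.

Let nu_sigma_additive : semi_sigma_additive nu.
Proof.
move=> F mF tF mUF; rewrite /density ge0_integral_bigcup//.
- by apply: is_cvg_ereal_nneg_natsum_cond => n _ _; exact: nu_ge0.
- by apply/measurable_EFinP; exact: measurable_funTS.
- by move=> x _; rewrite lee_fin.
Qed.

HB.instance Definition _ := isMeasure.Build _ _ _ nu nu0 nu_ge0 nu_sigma_additive.
End density.

(** * Gaussian vectors and their shifts *)

Lemma indic_mx_rect {d} {T : measurableType d} {R : comNzRingType} {n : nat}
    (B : 'I_n -> 'I_1 -> set T) (v : 'cV[T]_n) :
  \1_(mx_rect B) v = \prod_i \1_(B i 0) (v i 0) :> R.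
Proof.
rewrite indicE; have [Bv|/existsNP[i nB]] := pselect (forall i, B i 0 (v i 0)).
  rewrite mem_set; last by move=> i j; rewrite (ord1 j); exact: Bv.
  by rewrite big1// => i _; rewrite indicE mem_set//; exact: Bv.
rewrite memNset; last by move=> Bv; exact/nB/Bv.
by rewrite (bigD1 i)//= indicE memNset// mul0r.
Qed.

Section gaussian_vector.
Context {d} {T : measurableType d} {R : realType} {n : nat}.
Variables (P : probability T R) (sigma : R) (z : {RV P >-> 'cV[R]_n}).
Hypothesis sigma0 : sigma != 0.
Hypothesis iidz : iid P (fun (i : 'I_n) w => z w i 0) (normal_prob 0 sigma).

(** The logarithm of the likelihood ratio, at the observation [v], between
    Gaussian noise shifted by [a] and centred Gaussian noise. *)
Definition log_lr (a v : 'cV[R]_n) : R :=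
  \sum_i (a i 0 * v i 0 / sigma ^+ 2 - a i 0 ^+ 2 / (2 * sigma ^+ 2)).

Lemma measurable_log_lr a : measurable_fun setT (log_lr a).
Proof.
apply: measurable_sum => i; apply: measurable_funB => //.
apply: measurable_funM => //; apply: measurable_funM => //.
exact: measurable_mx_entry.
Qed.

Lemma measurable_lr a : measurable_fun setT (fun v => expR (log_lr a v)).
Proof. by apply: measurableT_comp => //; exact: measurable_log_lr. Qed.

Lemma lr_ge0 a v : 0 <= expR (log_lr a v). Proof. exact: expR_ge0. Qed.

Lemma measurable_mx_shift (a : 'cV[R]_n) :
  measurable_fun setT (fun v : 'cV[R]_n => v + a).
Proof.
apply: measurable_fun_mx => i j; under eq_fun do rewrite mxE.
by apply: measurable_funD => //; exact: measurable_mx_entry.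
Qed.

Local Notation gamma := (distribution P z).

(** Both sides are finite measures in [A], so it is enough to compare them on
    product sets; there [iid_integral_prod] factors them and each factor is the
    one-dimensional formula [normal_prob_shift]. *)
Lemma gaussian_shift (a : 'cV[R]_n) (A : set 'cV[R]_n) : measurable A ->
  gamma ((fun v => v + a) @^-1` A) = (\int[gamma]_(v in A) (expR (log_lr a v))%:E)%E.
Proof.
have mz i : measurable_fun setT (fun w => z w i 0).
  by apply: (measurableT_comp (measurable_mx_entry i 0)).
pose phi : {mfun 'cV[R]_n >-> 'cV[R]_n} :=
  HB.pack (fun v : 'cV[R]_n => v + a)
    (isMeasurableFun.Build _ _ _ _ _ (measurable_mx_shift a)).
pose m1 : {measure set 'cV[R]_n -> \bar R} := distribution gamma phi.
pose m2 : {measure set 'cV[R]_n -> \bar R} :=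
  density gamma _ (measurable_lr a) (lr_ge0 a).
move: A; apply: (@mx_measure_unique _ _ _ _ _ m1 m2).
  by rewrite /m1 /pushforward /= preimage_setT probability_setT ltry.
move=> B mB.
pose f1 i y := \1_(B i 0) (y + a i 0) : R.
pose f2 i y := \1_(B i 0) y *
  expR (a i 0 * y / sigma ^+ 2 - a i 0 ^+ 2 / (2 * sigma ^+ 2)).
have m1B i : measurable_fun setT (\1_(B i 0) : R -> R).
  exact: measurable_indic.
have mf1 i : measurable_fun setT (f1 i).
  by apply: (measurableT_comp (m1B i)); exact: measurable_funD.
have mf2 i : measurable_fun setT (f2 i).
  apply: measurable_funM; first exact: m1B.
  apply: (measurableT_comp (@measurable_expR R)).
  apply: measurable_funB => //; apply: measurable_funM => //.
pose g i := fine (\int[normal_prob 0 sigma]_y (f1 i y)%:E).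
have gE i : (\int[normal_prob 0 sigma]_y (f1 i y)%:E = (g i)%:E)%E.
  rewrite fineK// ge0_fin_numE; last by apply: integral_ge0 => y _; rewrite lee_fin.
  apply: (@le_lt_trans _ _ (\int[normal_prob 0 sigma]_y 1)%E); last first.
    rewrite integral_cst// mul1e.
    by apply: (le_lt_trans (@probability_le1 _ _ _ (normal_prob 0 sigma) setT _));
      rewrite ?ltry.
  apply: ge0_le_integral => //.
  - by move=> y _; rewrite lee_fin.
  - apply/measurable_EFinP; exact: mf1.
  - by move=> y _; rewrite lee_fin /f1 indicE; case: (_ \in _).
have mR : measurable (mx_rect B) by exact: measurable_mx_rect.
transitivity (\prod_i g i)%:E.
  rewrite -(iid_integral_prod P _ (normal_prob 0 sigma) mz iidz f1 g)//.
  transitivity (\int[P]_w (\1_(z @^-1` (phi @^-1` mx_rect B)) w)%:E)%E.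
    rewrite integral_indic ?setIT//.
    by rewrite -[_ @^-1` _]setTI; apply: measurable_funPT => //;
      rewrite -[_ @^-1` _]setTI; apply: measurable_mx_shift.
  apply: eq_integral => w _; congr EFin.
  transitivity (\1_(mx_rect B) (z w + a) : R); first by [].
  by rewrite indic_mx_rect; apply: eq_bigr => i _; rewrite !mxE.
rewrite -(iid_integral_prod P _ (normal_prob 0 sigma) mz iidz f2 g)//; last 2 first.
- by move=> i y; rewrite /f2 mulr_ge0 ?expR_ge0.
- move=> i; rewrite -gE.
  have := normal_prob_shift sigma (a i 0) (fun y => (\1_(B i 0) y)%:E) sigma0.
  move=> <-.
  + by apply: eq_integral => y _; rewrite /f2 EFinM.
  + by apply/measurable_EFinP; exact: m1B.
  + by move=> y; rewrite lee_fin.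
rewrite /m2 /= /density integral_mkcond epatch_indic ge0_integral_distribution//=.
- apply: eq_integral => w _ /=; rewrite -EFinM mulrC indic_mx_rect.
  by rewrite /log_lr expR_sum -big_split.
- apply: emeasurable_funM; apply/measurable_EFinP => //; exact: measurable_lr.
Qed.
End gaussian_vector.

Section gaussian_vector2.
Context {d} {T : measurableType d} {R : realType} {n : nat}.
Variables (P : probability T R) (sigma : R) (z : {RV P >-> 'cV[R]_n}).
Hypothesis sigma0 : sigma != 0.
Hypothesis iidz : iid P (fun (i : 'I_n) w => z w i 0) (normal_prob 0 sigma).

Lemma log_lrZ (s : R) (a v : 'cV[R]_n) :
  s * log_lr sigma a v = log_lr sigma (s *: a) v
    + s * (s - 1) * (\sum_i a i 0 ^+ 2) / (2 * sigma ^+ 2).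
Proof.
rewrite mulrAC mulr_sumr !mulr_sumr -big_split /=; apply: eq_bigr => i _.
by rewrite mxE; field.
Qed.

(** For a likelihood ratio [L], either [L <= e^l] or
    [L <= L^(1+s) e^(-s l)].  By [log_lrZ] the power [1 + s] of a
    Gaussian likelihood ratio is again one, for the dilated shift, up to a
    deterministic factor. *)
Lemma lr_truncation (s l : R) (a v : 'cV[R]_n) : 0 <= s ->
  expR (log_lr sigma a v) <= expR l + expR (log_lr sigma ((1 + s) *: a) v) *
     expR (s * (1 + s) * (\sum_i a i 0 ^+ 2) / (2 * sigma ^+ 2) - s * l).
Proof.
move=> s0; have [tl|lt] := leP (log_lr sigma a v) l.
  by rewrite -[leLHS]addr0 lerD ?ler_expR// mulr_ge0 ?expR_ge0.
rewrite -[leLHS]add0r lerD ?expR_ge0// -expRD ler_expR addrA.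
have := log_lrZ (1 + s) a v; rewrite (_ : 1 + s - 1 = s); last by ring.
rewrite [(1 + s) * s]mulrC => <-.
have : 0 <= s * (log_lr sigma a v - l) by rewrite mulr_ge0// subr_ge0 ltW.
lra.
Qed.

Local Notation gamma := (distribution P z).

(** A shift of Gaussian noise multiplies probabilities by at most [expR l], up
    to an additive error: integrate [lr_truncation], the likelihood ratio of the
    dilated shift having total mass one. *)
Lemma gaussian_shift_le (a : 'cV[R]_n) (s l : R) (A : set 'cV[R]_n) :
  0 <= s -> measurable A ->
  (gamma ((fun v => v + a)%R @^-1` A) <= (expR l)%:E * gamma A +
    (expR (s * (1 + s) * (\sum_i a i 0 ^+ 2) / (2 * sigma ^+ 2) - s * l)%R)%:E)%E.
Proof.
move=> s0 mA; rewrite (gaussian_shift P sigma z sigma0 iidz)//.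
set c := expR (s * (1 + s) * _ / _ - _).
have c0 : (0 <= c%:E)%E by rewrite lee_fin; exact: expR_ge0.
have mlr b : measurable_fun A (fun v => (expR (log_lr sigma b v))%:E).
  by apply/measurable_EFinP/measurable_funTS; exact: measurable_lr.
apply: (@le_trans _ _ (\int[gamma]_(v in A)
   ((expR l)%:E + c%:E * (expR (log_lr sigma ((1 + s) *: a)%R v))%:E))%E).
  apply: ge0_le_integral => //.
  - by apply: emeasurable_funD => //; exact: emeasurable_funM.
  - move=> v _; rewrite -EFinM -EFinD lee_fin mulrC; exact: lr_truncation.
rewrite ge0_integralD//; last 2 first.
- by move=> v _; rewrite mule_ge0// lee_fin expR_ge0.
- exact: emeasurable_funM.
rewrite integral_cst// leeD// ge0_integralZl//.
rewrite -[leRHS]mule1; apply: lee_wpmul2l => //.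
rewrite -(gaussian_shift P sigma z sigma0 iidz)//; apply: probability_le1.
by rewrite -[_ @^-1` _]setTI; exact: measurable_mx_shift.
Qed.

End gaussian_vector2.

(** * The linear model with a Gaussian design *)

Lemma l2norm_sqr {R : rcfType} {p : nat} (v : 'cV[R]_p) :
  l2norm v ^+ 2 = \sum_i v i 0 ^+ 2.
Proof. by rewrite sqr_sqrtr// sumr_ge0// => i _; exact: sqr_ge0. Qed.

Section gaussian_model.
Context {d} {T : measurableType d} {R : realType} {n p : nat}.
Variables (P : probability T R) (sigma : R).
Variables (X : {RV P >-> 'M[R]_(n, p)}) (z : {RV P >-> 'cV[R]_n}).
Hypothesis sigma0 : sigma != 0.
Hypothesis iidz : iid P (fun (i : 'I_n) w => z w i 0) (normal_prob 0 sigma).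
Hypothesis indXz : independent2 P X z.

Lemma measurable_mulmxr (b : 'cV[R]_p) :
  measurable_fun setT (fun A : 'M[R]_(n, p) => A *m b).
Proof.
apply: measurable_fun_mx => i j; under eq_fun do rewrite mxE.
apply: measurable_sum => k; apply: measurable_funM => //.
exact: measurable_mx_entry.
Qed.

Lemma measurable_fun_addmx {d'} {S : measurableType d'} {m q : nat}
    (f g : S -> 'M[R]_(m, q)) :
  measurable_fun setT f -> measurable_fun setT g ->
  measurable_fun setT (fun w => f w + g w).
Proof.
move=> mf mg; apply: measurable_fun_mx => i j; under eq_fun do rewrite mxE.
by apply: measurable_funD; [apply: (measurableT_comp (measurable_mx_entry i j) mf)|
  apply: (measurableT_comp (measurable_mx_entry i j) mg)].
Qed.

Lemma measurable_model (b : 'cV[R]_p) :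
  measurable_fun setT (fun xv : 'M[R]_(n, p) * 'cV[R]_n => (xv.1, xv.1 *m b + xv.2)).
Proof.
apply/measurable_fun_pair => //=.
apply: measurable_fun_addmx => //.
exact: (measurableT_comp (measurable_mulmxr b)).
Qed.

Lemma measurable_observation (b : 'cV[R]_p) :
  measurable_fun setT (fun w => (X w, X w *m b + z w)).
Proof.
apply/measurable_fun_pair => //; apply: measurable_fun_addmx => //.
exact: (measurableT_comp (measurable_mulmxr b)).
Qed.

Lemma measurable_loss (bh : {mfun ('M[R]_(n, p) * 'cV[R]_n)%type >-> 'cV[R]_p})
    (b : 'cV[R]_p) :
  measurable_fun setT (fun w => l2norm (bh (X w, X w *m b + z w) - b) ^+ 2).
Proof.
under eq_fun do rewrite l2norm_sqr.
apply: measurable_sum => i; apply: measurable_funX.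
apply: (measurableT_comp (measurable_mx_entry i 0)).
apply: measurable_fun_addmx => //.
apply: (@measurableT_comp _ _ _ _ _ _ bh) => //.
exact: measurable_observation.
Qed.

(** Since design and noise are independent, the design may be conditioned
    upon: it is integrated last, the noise keeping its own law. *)
Lemma model_law (b : 'cV[R]_p) (A : set ('M[R]_(n, p) * 'cV[R]_n)) : measurable A ->
  P [set w | A (X w, X w *m b + z w)%R] =
  (\int[distribution P X]_x distribution P z [set v | A (x, x *m b + v)%R])%E.
Proof.
move=> mA.
pose C := [set xv : 'M[R]_(n, p) * 'cV[R]_n | A (xv.1, xv.1 *m b + xv.2)].
have mC : measurable C by rewrite -[C]setTI; exact: measurable_model.
have mXz : measurable_fun setT (fun w => (X w, z w)) by exact/measurable_fun_pair.
pose Xz : {mfun T >-> ('M[R]_(n, p) * 'cV[R]_n)%type} :=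
  HB.pack (fun w => (X w, z w)) (isMeasurableFun.Build _ _ _ _ _ mXz).
have := @product_measure_unique _ _ _ _ R (distribution P X) (distribution P z)
   (distribution P Xz).
have h : forall A B, measurable A -> measurable B ->
  distribution P Xz (A `*` B) = (distribution P X A * distribution P z B)%E.
  by move=> A' B' mA' mB'; exact: indXz.
move=> /(_ h C mC)/esym E; apply: (etrans E).
apply: eq_integral => x _; congr (distribution P z _).
by apply/seteqP; split => v /=; rewrite /xsection /= inE.
Qed.

(** The bound of [gaussian_shift_le] for the shift [X *m h], integrated over the
    design. *)
Lemma model_shift_le (b h : 'cV[R]_p) (s l : R) (A : set ('M[R]_(n, p) * 'cV[R]_n)) :
  0 <= s -> measurable A ->
  (P [set w | A (X w, X w *m (b + h) + z w)%R] <=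
   (expR l)%:E * P [set w | A (X w, X w *m b + z w)%R] +
   (expR (- (s * l))%R)%:E * \int[P]_w (expR (s * (1 + s) / (2 * sigma ^+ 2)
        * \sum_i (X w *m h) i 0 ^+ 2)%R)%:E)%E.
Proof.
move=> s0 mA; rewrite !model_law//.
pose A0 (x : 'M[R]_(n, p)) := [set v : 'cV[R]_n | A (x, x *m b + v)].
have mA0 x : measurable (A0 x).
  have mpair : measurable_fun setT (fun v : 'cV[R]_n => (x, x *m b + v)).
    by apply/measurable_fun_pair => //; exact: measurable_fun_addmx.
  by rewrite -[A0 x]setTI; exact: mpair.
have mC c : measurable [set xv : 'M[R]_(n, p) * 'cV[R]_n | A (xv.1, xv.1 *m c + xv.2)].
  by rewrite -[X in measurable X]setTI; exact: measurable_model.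
have mfib c : measurable_fun setT
    (fun x : 'M[R]_(n, p) => distribution P z [set v : 'cV[R]_n | A (x, x *m c + v)]).
  have := measurable_fun_xsection (distribution P z) (mC c).
  apply: eq_measurable_fun => x _; congr (distribution P z _).
  by apply/seteqP; split => v /=; rewrite /xsection /= inE.
have msq : measurable_fun setT (fun x : 'M[R]_(n, p) =>
    expR (s * (1 + s) / (2 * sigma ^+ 2) * \sum_i (x *m h) i 0 ^+ 2)).
  apply: (measurableT_comp (@measurable_expR R)); apply: measurable_funM => //.
  apply: measurable_sum => i; apply: measurable_funX.
  by apply: (measurableT_comp (measurable_mx_entry i 0)); exact: measurable_mulmxr.
rewrite -(ge0_integral_distribution X (f := fun x : 'M[R]_(n, p) =>
    (expR (s * (1 + s) / (2 * sigma ^+ 2) * \sum_i (x *m h) i 0 ^+ 2))%:E)) //;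
  last exact/measurable_EFinP.
have mfib' : measurable_fun setT (fun x : 'M[R]_(n, p) =>
    (expR l)%:E * distribution P z [set v : 'cV[R]_n | A (x, x *m b + v)%R])%E.
  exact: emeasurable_funM.
rewrite -!ge0_integralZl//; last by exact/measurable_EFinP.
rewrite -ge0_integralD//; last 2 first.
- by move=> x _; rewrite mule_ge0.
- by apply: emeasurable_funM => //; exact/measurable_EFinP.
apply: ge0_le_integral => //.
- by apply: emeasurable_funD => //; apply: emeasurable_funM => //; exact/measurable_EFinP.
- move=> x _; rewrite -EFinM -expRD.
  have -> : - (s * l) + s * (1 + s) / (2 * sigma ^+ 2) * (\sum_i (x *m h) i 0 ^+ 2) =
      s * (1 + s) * (\sum_i (x *m h) i 0 ^+ 2) / (2 * sigma ^+ 2) - s * l.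
    by rewrite addrC; congr (_ + _); exact: mulrAC.
  have -> : [set v : 'cV[R]_n | A (x, x *m (b + h) + v)] =
      (fun v => v + x *m h) @^-1` (A0 x).
    by apply/seteqP; split => v /=; rewrite /A0 /= mulmxDr -addrA [v + _]addrC.
  exact: gaussian_shift_le.
Qed.
End gaussian_model.

Section design.
Context {d} {T : measurableType d} {R : realType} {n p : nat}.
Variables (P : probability T R) (sigma : R).
Variables (X : {RV P >-> 'M[R]_(n, p)}) (z : {RV P >-> 'cV[R]_n}).
Hypotheses (sigma0 : 0 < sigma) (n0 : (0 < n)%N).
Hypothesis iidX : iid P (fun (ij : 'I_n * 'I_p) w => X w ij.1 ij.2)
                    (normal_prob 0 (Num.sqrt n%:R)^-1).
Hypothesis iidz : iid P (fun (i : 'I_n) w => z w i 0) (normal_prob 0 sigma).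
Hypothesis indXz : independent2 P X z.

Lemma exp_sqr_column (c : R) (j : 'I_p) : 2 * c / n%:R < 1 ->
  (\int[P]_w (expR (c * \sum_i (X w i j) ^+ 2)%R)%:E =
   (Num.sqrt (1 - 2 * c / n%:R)^-1 ^+ n)%:E)%E.
Proof.
move=> c1; pose s : R := (Num.sqrt n%:R)^-1.
have nR0 : 0 < n%:R :> R by rewrite ltr0n.
have s0 : 0 < s by rewrite invr_gt0 sqrtr_gt0.
have s2 : s ^+ 2 = n%:R^-1 by rewrite /s exprVn sqr_sqrtr// ltW.
(* The factors outside column [j] are constant, so that the product rule for
   all entries of the design yields the one for a column. *)
pose f (ij : 'I_n * 'I_p) (y : R) := if ij.2 == j then expR (c * y ^+ 2) else 1.
pose g (ij : 'I_n * 'I_p) := if ij.2 == j then Num.sqrt (1 - 2 * c / n%:R)^-1 else 1.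
have prodE (h : 'I_n -> R) :
    \prod_(ij : 'I_n * 'I_p) (if ij.2 == j then h ij.1 else 1) = \prod_i h i.
  rewrite -(pair_bigA _ (fun i k => if k == j then h i else 1)) /=.
  by apply: eq_bigr => i _; rewrite -big_mkcond big_pred1_eq.
have -> : Num.sqrt (1 - 2 * c / n%:R)^-1 ^+ n = \prod_ij g ij.
  by rewrite (prodE (fun=> Num.sqrt (1 - 2 * c / n%:R)^-1)) prodr_const card_ord.
have mX ij : measurable_fun setT (fun w => X w ij.1 ij.2).
  by apply: (measurableT_comp (measurable_mx_entry ij.1 ij.2)).
rewrite -(iid_integral_prod P _ (normal_prob 0 s) mX iidX f g).
- apply: eq_integral => w _; congr EFin.
  transitivity (\prod_i expR (c * X w i j ^+ 2)); first by rewrite mulr_sumr expR_sum.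
  by rewrite -(prodE (fun i => expR (c * X w i j ^+ 2)));
    apply: eq_bigr => ij _; rewrite /f; case: eqP => // ->.
- move=> ij; rewrite /f; case: (ij.2 == j); last exact: measurable_cst.
  apply: (measurableT_comp (@measurable_expR R)).
  by apply: measurable_funM => //; exact: measurable_funX.
- by move=> ij y; rewrite /f; case: ifP; rewrite ?expR_ge0.
- move=> ij; rewrite /f /g; case: (ij.2 == j).
    by rewrite normal_prob_exp_sqr ?s2.
  by rewrite integral_cst// mul1e; exact: (@probability_setT _ _ _ (normal_prob 0 s)).
Qed.

(** From [(1 - x)^-1 = 1 + x / (1 - x)] and [1 + y <= expR y].  For a small [x]
    the exponent is close to [m%:R * x / 2]: to first order the squared norm of
    a column of the design may be replaced by its mean. *)
Lemma sqrt_inv_exp_le (x : R) (m : nat) : 0 <= x -> x < 1 ->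
  Num.sqrt (1 - x)^-1 ^+ m <= expR (m%:R * x / 2 / (1 - x)).
Proof.
move=> x0 x1; have y0 : 0 < 1 - x by rewrite subr_gt0.
have -> : m%:R * x / 2 / (1 - x) = m%:R * (x / (1 - x) / 2) by field; rewrite gt_eqF.
rewrite expRM_natl lerXn2r ?nnegrE ?sqrtr_ge0 ?expR_ge0//.
rewrite -(@ler_pXn2r _ 2) ?nnegrE ?sqrtr_ge0 ?expR_ge0//.
rewrite sqr_sqrtr ?invr_ge0 ?(ltW y0)// -expRM_natl mulrC divfK//.
have {1}-> : (1 - x)^-1 = 1 + x / (1 - x) by field; rewrite gt_eqF.
exact: expR_ge1Dx.
Qed.

(** The cost of adding one spike, with the Gaussian column integrated out: [c]
    is the exponent that a column of norm exactly one would give, and the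
    denominator accounts for its fluctuations. *)
Lemma spike_shift_le (b : 'cV[R]_p) (j : 'I_p) (tau s l : R)
    (A : set ('M[R]_(n, p) * 'cV[R]_n)) :
  let c := s * (1 + s) * tau ^+ 2 / (2 * sigma ^+ 2) in
  0 <= s -> 2 * c / n%:R < 1 -> measurable A ->
  (P [set w | A (X w, X w *m (b + tau *: delta_mx j 0) + z w)%R] <=
   (expR l)%:E * P [set w | A (X w, X w *m b + z w)%R] +
   (expR (c / (1 - 2 * c / n%:R) - s * l))%:E)%E.
Proof.
move=> c s0 c1 mA.
have nR0 : 0 < n%:R :> R by rewrite ltr0n.
have c0 : 0 <= c.
  apply: divr_ge0; last by apply: mulr_ge0 => //; exact: sqr_ge0.
  apply: mulr_ge0; last exact: sqr_ge0.
  by apply: mulr_ge0 => //; exact: addr_ge0.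
apply: (le_trans (model_shift_le P sigma X z _ iidz indXz b _ s l A s0 mA)).
  by rewrite gt_eqF.
rewrite leeD2l//.
have quadE w : s * (1 + s) / (2 * sigma ^+ 2) *
    \sum_i (X w *m (tau *: delta_mx j 0)) i 0 ^+ 2 = c * \sum_i (X w i j) ^+ 2.
  rewrite /c [s * _ * _ / _]mulrAC -[RHS]mulrA; congr (_ * _).
  rewrite mulr_sumr; apply: eq_bigr => i _.
  rewrite -exprMn mxE (bigD1 j)//= big1 => [|k kj]; rewrite !mxE ?eqxx ?(negbTE kj) /=.
    by rewrite mulr1 addr0 mulrC.
  by rewrite !mulr0.
under eq_integral do rewrite quadE.
rewrite exp_sqr_column// -EFinM lee_fin [X in _ <= expR X]addrC expRD ler_wpM2l ?expR_ge0//.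
apply: (le_trans (sqrt_inv_exp_le _ _ _ _)) => //.
  by apply: divr_ge0; [exact: mulr_ge0|exact: ltW].
rewrite ler_expR le_eqVlt; apply/orP; left; apply/eqP; congr (_ / _).
by field; rewrite gt_eqF.
Qed.
End design.

(** * List decoding of spikes *)

Section list_decoding.
Context {R : realFieldType}.

Definition spike_dist {q : nat} (tau : R) (u : 'I_q -> R) (j : 'I_q) : R :=
  \sum_i (u i - tau * (i == j)%:R) ^+ 2.

Lemma spike_dist_ge0 {q : nat} tau (u : 'I_q -> R) j : 0 <= spike_dist tau u j.
Proof. by apply: sumr_ge0 => i _; exact: sqr_ge0. Qed.

Lemma spike_distE {q : nat} tau (u : 'I_q -> R) j :
  spike_dist tau u j = \sum_i u i ^+ 2 - 2 * tau * u j + tau ^+ 2.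
Proof.
rewrite /spike_dist (bigD1 j)//= eqxx [\sum_i u i ^+ 2](bigD1 j)//=.
rewrite [X in _ + X](eq_bigr (fun i => u i ^+ 2)); first by ring.
by move=> i ij; rewrite (negbTE ij) mulr0 subr0.
Qed.

(** List decoding: with [U] the squared norm of [u], each spike [j] counted here
    satisfies [2 * tau * u j > U + delta * tau ^+ 2].  Inserting this in the
    squares [(u j / delta - tau) ^+ 2], whose sum over the counted spikes is
    nonnegative, bounds their number. *)
Lemma near_spikes_card {q : nat} (tau delta : R) (u : 'I_q -> R) : 0 < delta ->
  \sum_j (spike_dist tau u j < (1 - delta) * tau ^+ 2)%R%:R <= delta^-1.
Proof.
move=> d0; set S := fun j => spike_dist tau u j < (1 - delta) * tau ^+ 2.
set U := \sum_i u i ^+ 2.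
have U0 : 0 <= U by apply: sumr_ge0 => i _; exact: sqr_ge0.
have SU j : S j -> U + delta * tau ^+ 2 < 2 * tau * u j.
  by rewrite /S spike_distE -/U => h; lra.
(* For [u = 0] no spike is counted. *)
have [Ugt|] := ltP 0 U; last first.
  move=> Ule; have uU i : u i = 0.
    apply/eqP; rewrite -sqrf_eq0 eq_le sqr_ge0 andbT (le_trans _ Ule)//.
    by rewrite /U (bigD1 i)//= lerDl sumr_ge0// => j _; exact: sqr_ge0.
  rewrite big1 ?invr_ge0 ?(ltW d0)// => j _.
  have [Sj|Sj] := boolP (S j); last by rewrite -/(S j) (negbTE Sj).
  have := SU j Sj; rewrite uU mulr0 => h.
  have : 0 <= delta * tau ^+ 2 by rewrite mulr_ge0 ?sqr_ge0// ltW.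
  lra.
pose m : R := \sum_j (S j)%:R; rewrite -[leLHS]/m.
suff : 0 <= U / delta * (delta^-1 - m).
  by rewrite pmulr_rge0 ?divr_gt0// subr_ge0.
have dV : delta * delta^-1 = 1 by rewrite divff// gt_eqF.
have h1 : 0 <= \sum_j (S j)%:R * (u j / delta - tau) ^+ 2.
  by apply: sumr_ge0 => j _; rewrite mulr_ge0 ?sqr_ge0.
apply: (le_trans h1).
apply: (@le_trans _ _ (\sum_j (u j ^+ 2 / delta ^+ 2 + (S j)%:R *
    (- ((U + delta * tau ^+ 2) / delta) + tau ^+ 2)))).
  apply: ler_sum => j _; case: (boolP (S j)) => Sj; last first.
    by rewrite !mul0r addr0 divr_ge0 ?sqr_ge0.
  rewrite !mul1r.
  have -> : (u j / delta - tau) ^+ 2 =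
      u j ^+ 2 / delta ^+ 2 + (- (2 * tau * u j / delta) + tau ^+ 2).
    by field; rewrite gt_eqF.
  by rewrite lerD2l lerD2r lerN2 ler_pM2r ?invr_gt0// ltW// SU.
rewrite big_split /= -!mulr_suml -/U -/m le_eqVlt; apply/orP; left; apply/eqP.
by field; rewrite gt_eqF.
Qed.

(** Markov's inequality for the uniform measure on the blocks. *)
Lemma count_markov {k : nat} (S : 'I_k -> R) (t theta : R) : 0 < t ->
  (forall b, 0 <= S b) -> \sum_b S b <= theta * t * k%:R ->
  (1 - theta) * k%:R <= \sum_b (S b < t)%R%:R.
Proof.
move=> t0 S0 hS.
suff h : t * \sum_b (1 - (S b < t)%R%:R) <= \sum_b S b.
  have := le_trans h hS; rewrite sumrB sumr_const card_ord => h'.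
  by rewrite -(ler_pM2l t0); lra.
rewrite mulr_sumr; apply: ler_sum => b _.
by case: ltP => Sb; rewrite ?subrr ?mulr0 ?subr0 ?mulr1.
Qed.
End list_decoding.

Section resample.
Context {R : realFieldType} {k q : nat}.
Local Notation conf := {ffun 'I_k -> 'I_q}.

Definition upd (J : conf) (b : 'I_k) (j : 'I_q) : conf :=
  [ffun b' => if b' == b then j else J b'].

(** Under the uniform law on configurations, the position in block [b] is
    independent of the other positions.  The proof swaps that position with a
    fresh one, an involution of [conf * 'I_q]. *)
Lemma sum_resample (b : 'I_k) (G : conf -> 'I_q -> R) :
  (forall J i j, G (upd J b i) j = G J j) ->
  q%:R * \sum_J G J (J b) = \sum_J \sum_j G J j.
Proof.
move=> Gupd.
pose phi (Jj : conf * 'I_q) := (upd Jj.1 b Jj.2, Jj.1 b).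
have phiK : involutive phi.
  move=> [J j]; rewrite /phi /= /upd ffunE eqxx; congr (_, _).
  by apply/ffunP => b'; rewrite !ffunE; case: eqP => // ->.
rewrite (pair_bigA _ (fun J j => G J j)) /= (reindex_inj (inv_inj phiK)) /=.
rewrite -(pair_bigA _ (fun J j => G (upd J b j) (J b))) /= mulr_sumr.
apply: eq_bigr => J _; rewrite (eq_bigr (fun=> G J (J b))) => [|j _]; last exact: Gupd.
by rewrite sumr_const card_ord mulr_natl.
Qed.
End resample.

Section spikes.
Context {R : realFieldType} {k q p : nat}.
(* [idx b i] is the coordinate of position [i] in block [b]. *)
Variable idx : 'I_k -> 'I_q -> 'I_p.
Hypothesis idx_inj : injective (fun bi : 'I_k * 'I_q => idx bi.1 bi.2).
Local Notation conf := {ffun 'I_k -> 'I_q}.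

Definition spike (tau : R) (b : 'I_k) (j : 'I_q) : 'cV[R]_p :=
  tau *: delta_mx (idx b j) 0.

Definition spikes (tau : R) (J : conf) : 'cV[R]_p := \sum_b spike tau b (J b).

Lemma spikes_entry tau (J : conf) b i :
  spikes tau J (idx b i) 0 = tau * (i == J b)%:R.
Proof.
have idxE b1 i1 b2 i2 : (idx b1 i1 == idx b2 i2) = (b1 == b2) && (i1 == i2).
  apply/eqP/andP => [E|[/eqP-> /eqP->]//].
  by have [-> ->] := @idx_inj (b1, i1) (b2, i2) E.
rewrite /spikes summxE (bigD1 b)//= big1 ?addr0 => [|b' b'b].
  by rewrite !mxE idxE !eqxx andbT.
by rewrite !mxE idxE eq_sym (negbTE b'b) mulr0.
Qed.

Lemma l0norm_spikes tau (J : conf) : (l0norm (spikes tau J) <= k)%N.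
Proof.
rewrite /l0norm -[X in (_ <= X)%N]card_ord.
apply: leq_trans (leq_image_card (fun b => idx b (J b)) predT).
apply: subset_leq_card; apply/fintype.subsetP => l; rewrite inE; apply: contraNT => lJ.
rewrite /spikes summxE big1// => b _; rewrite !mxE eqxx andbT.
case: eqP => [lE|]; last by rewrite mulr0.
by case/negP: lJ; rewrite lE fintype.image_f.
Qed.

Lemma spikes_loss tau (J : conf) (v : 'cV[R]_p) :
  \sum_b spike_dist tau (fun i => v (idx b i) 0) (J b) <=
  \sum_l (v - spikes tau J) l 0 ^+ 2.
Proof.
pose F l := (v - spikes tau J) l 0 ^+ 2.
have F0 l : 0 <= F l by exact: sqr_ge0.
rewrite (eq_bigr (fun b => \sum_i F (idx b i))) => [|b _]; last first.
  by apply: eq_bigr => i _; rewrite /F !mxE; rewrite -spikes_entry.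
rewrite pair_bigA /=.
pose h (bi : 'I_k * 'I_q) := idx bi.1 bi.2.
have E : \sum_(j in finset.imset h (mem predT)) F j = \sum_bi F (h bi).
  by rewrite big_imset//= => x y _ _; exact: idx_inj.
rewrite -[leLHS]E [leRHS](bigID (mem (finset.imset h (mem predT)))) /= lerDl.
by apply: sumr_ge0 => l _; exact: F0.
Qed.
End spikes.

(** * The Bayes risk under the block prior *)

Section counting_events.
Context {d} {T : measurableType d} {R : realType} {I : finType}.
Variables (P : probability T R) (A : I -> set T).
Hypothesis mA : forall i, measurable (A i).

Lemma sum_prob : (\sum_i fine (P (A i)))%:E =
  (\int[P]_w (\sum_i \1_(A i) w : R)%:E)%E.
Proof.
under eq_integral do rewrite -sumEFin.
rewrite ge0_integral_sum//; last first.
  by move=> i; apply/measurable_EFinP; exact: measurable_indic.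
rewrite -sumEFin; apply: eq_bigr => i _.
by rewrite integral_indic// setIT fineK// fin_num_measure.
Qed.

Lemma sum_prob_le (C : R) : (forall w, \sum_i \1_(A i) w <= C) ->
  \sum_i fine (P (A i)) <= C.
Proof.
move=> AC; rewrite -lee_fin sum_prob.
apply: (@le_trans _ _ (\int[P]_w C%:E)%E).
  apply: ge0_le_integral => //.
  - by move=> w _; rewrite lee_fin sumr_ge0.
  - by apply/measurable_EFinP; apply: measurable_sum => i; exact: measurable_indic.
  - by move=> w _; rewrite lee_fin.
by rewrite integral_cst// [X in (_ * X)%E](@probability_setT _ _ _ P) mule1.
Qed.

Lemma prob_le_sum (c : R) (D : set T) : measurable D -> 0 <= c ->
  (forall w, c * \1_D w <= \sum_i \1_(A i) w) ->
  c * fine (P D) <= \sum_i fine (P (A i)).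
Proof.
move=> mD c0 DA; rewrite -lee_fin sum_prob EFinM fineK ?fin_num_measure//.
have -> : P D = (\int[P]_w (\1_D w)%:E)%E by rewrite integral_indic// setIT.
rewrite -ge0_integralZl//.
- apply: ge0_le_integral => //.
  + by move=> w _; rewrite -EFinM lee_fin mulr_ge0.
  + by apply: emeasurable_funM => //; apply/measurable_EFinP; exact: measurable_indic.
  + by apply/measurable_EFinP; apply: measurable_sum => i; exact: measurable_indic.
  + by move=> w _; rewrite -EFinM lee_fin.
- by apply/measurable_EFinP; exact: measurable_indic.
Qed.
End counting_events.

Section bayes.
Context {d} {T : measurableType d} {R : realType} {n p k q : nat}.
Variables (P : probability T R) (sigma : R).
Variables (X : {RV P >-> 'M[R]_(n, p)}) (z : {RV P >-> 'cV[R]_n}).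
Hypotheses (sigma0 : 0 < sigma) (n0 : (0 < n)%N).
Hypothesis iidX : iid P (fun (ij : 'I_n * 'I_p) w => X w ij.1 ij.2)
                    (normal_prob 0 (Num.sqrt n%:R)^-1).
Hypothesis iidz : iid P (fun (i : 'I_n) w => z w i 0) (normal_prob 0 sigma).
Hypothesis indXz : independent2 P X z.
Variable bh : {mfun ('M[R]_(n, p) * 'cV[R]_n)%type >-> 'cV[R]_p}.
Variable idx : 'I_k -> 'I_q -> 'I_p.
Hypothesis idx_inj : injective (fun bi : 'I_k * 'I_q => idx bi.1 bi.2).
Hypotheses (k0 : (0 < k)%N) (q1 : (1 < q)%N).
Variable delta : R.
Hypotheses (delta0 : 0 < delta) (delta1 : delta < 1).
Let Lam : R := ln q%:R.
Hypothesis Lam_n : 4 * Lam / n%:R <= delta / 8.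

(* Below the detection threshold [2 * sigma ^+ 2 * Lam] for the squared height
   the spikes stay hidden; the factor [1 - delta] is the margin. *)
Let tau : R := Num.sqrt ((1 - delta) * 2 * sigma ^+ 2 * Lam).
Local Notation conf := {ffun 'I_k -> 'I_q}.

(* The list of block [b] consists of the positions [j] for which the data lie
   in [decoded b j]. *)
Let decoded b j : set ('M[R]_(n, p) * 'cV[R]_n) :=
  [set xy | spike_dist tau (fun i => bh xy (idx b i) 0) j < (1 - delta) * tau ^+ 2].
Let pr (A : set ('M[R]_(n, p) * 'cV[R]_n)) (beta : 'cV[R]_p) : R :=
  fine (P [set w | A (X w, X w *m beta + z w)]).

Let Lam0 : 0 < Lam. Proof. by rewrite ln_gt0// ltr1n. Qed.

Let tau2 : tau ^+ 2 = (1 - delta) * 2 * sigma ^+ 2 * Lam.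
Proof.
rewrite sqr_sqrtr//; apply: mulr_ge0; last exact: ltW.
apply: mulr_ge0; last exact: sqr_ge0.
by apply: mulr_ge0 => //; rewrite subr_ge0 ltW.
Qed.

Let mdecoded b j : measurable (decoded b j).
Proof.
have mf : measurable_fun setT (fun xy => spike_dist tau (fun i => bh xy (idx b i) 0) j).
  apply: measurable_sum => i; apply: measurable_funX; apply: measurable_funB => //.
  exact: (measurableT_comp (measurable_mx_entry _ _)).
have := mf measurableT `]-oo, (1 - delta) * tau ^+ 2[%classic (measurable_itv _).
rewrite setTI; congr measurable.
Qed.

Let mset (A : set ('M[R]_(n, p) * 'cV[R]_n)) beta : measurable A ->
  measurable [set w | A (X w, X w *m beta + z w)].
Proof. by move=> mA; rewrite -[X in measurable X]setTI; exact: measurable_observation. Qed.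

(** Compared with the model without spike in block [b], the true position is
    decoded with a probability larger by at most the factor [expR l], up to a
    vanishing error. *)
Lemma decoded_prob_le b j (beta : 'cV[R]_p) :
  pr (decoded b j) (beta + spike idx tau b j) <=
  expR ((1 - delta / 2) * Lam) * pr (decoded b j) beta + expR (- (delta ^+ 2 * Lam / 32)).
Proof.
have nR0 : 0 < n%:R :> R by rewrite ltr0n.
(* The log-likelihood ratio concentrates at [(1 - delta) * Lam]: the threshold
   [l] lies above it, hence the small error, and below [Lam], hence a factor
   negligible against the number [q] of positions.  The power [s] is taken so
   small that [(1 + s) * (1 - delta)] remains below [1 - delta / 2]. *)
pose s := delta / 4; pose l := (1 - delta / 2) * Lam.
pose c := s * (1 + s) * tau ^+ 2 / (2 * sigma ^+ 2).
have cE : c = s * (1 + s) * (1 - delta) * Lam.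
  by rewrite /c tau2; field; rewrite gt_eqF.
have s0 : 0 <= s by rewrite /s divr_ge0// ltW.
have cL : c <= s * Lam * (1 - 3 / 4 * delta).
  rewrite cE [leLHS](_ : _ = s * Lam * ((1 + s) * (1 - delta))); last by ring.
  apply: ler_wpM2l; first by rewrite mulr_ge0// ltW.
  have := mulr_ge0 (ltW delta0) (ltW delta0); rewrite /s; lra.
have cn : 2 * c / n%:R <= delta / 8.
  apply: le_trans Lam_n; rewrite ler_pM2r ?invr_gt0//.
  have h1 : s * (1 - 3 / 4 * delta) <= 2.
    by have := mulr_ge0 s0 (ltW delta0); have := delta1; rewrite /s; lra.
  by have := ler_wpM2l (ltW Lam0) h1; move: cL; rewrite /s; lra.
have c1 : 2 * c / n%:R < 1 by apply: le_lt_trans cn _; have := delta1; lra.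
have := spike_shift_le P sigma X z sigma0 n0 iidX iidz indXz beta (idx b j) tau s l
  (decoded b j) s0 c1 (mdecoded b j).
rewrite -/c -[tau *: _]/(spike idx tau b j) => h.
have h' : pr (decoded b j) (beta + spike idx tau b j) <=
    expR l * pr (decoded b j) beta + expR (c / (1 - 2 * c / n%:R) - s * l).
  by rewrite -lee_fin EFinD EFinM !fineK ?fin_num_measure//; exact: mset.
apply: (le_trans h'); rewrite lerD2l ler_expR.
have x1 : 0 < 1 - 2 * c / n%:R by rewrite subr_gt0.
have sL : 0 <= s * Lam by rewrite mulr_ge0// ltW.
have : c / (1 - 2 * c / n%:R) <= s * Lam * (1 - 5 / 8 * delta).
  rewrite ler_pdivrMr// -[leRHS]mulrA; apply: (le_trans cL); apply: ler_wpM2l => //.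
  apply: (@le_trans _ _ ((1 - 5 / 8 * delta) * (1 - delta / 8))).
    have := mulr_ge0 (ltW delta0) (ltW delta0); lra.
  by apply: ler_wpM2l; [have := delta1; lra|rewrite lerD2l lerN2].
rewrite /l /s; lra.
Qed.

Let base b (J : conf) : 'cV[R]_p := \sum_(b' | b' != b) spike idx tau b' (J b').

Let spikes_base b J : spikes idx tau J = base b J + spike idx tau b (J b).
Proof. by rewrite /spikes (bigD1 b)//= addrC. Qed.

Let low_loss (J : conf) : set ('M[R]_(n, p) * 'cV[R]_n) :=
  [set xy | \sum_i (bh xy - spikes idx tau J) i 0 ^+ 2 <=
            (1 - delta) ^+ 2 * tau ^+ 2 * k%:R].

Let mlow_loss J : measurable (low_loss J).
Proof.
have mf : measurable_fun setT
    (fun xy => \sum_i (bh xy - spikes idx tau J) i 0 ^+ 2).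
  apply: measurable_sum => i; apply: measurable_funX.
  apply: (measurableT_comp (measurable_mx_entry i 0)).
  exact: measurable_fun_addmx.
have := mf measurableT `]-oo, (1 - delta) ^+ 2 * tau ^+ 2 * k%:R]%classic (measurable_itv _).
by rewrite setTI; congr measurable.
Qed.

Let tau20 : 0 < tau ^+ 2.
Proof.
rewrite tau2; apply: mulr_gt0 => //; apply: mulr_gt0; last exact: exprn_gt0.
by apply: mulr_gt0 => //; rewrite subr_gt0.
Qed.

(* If the loss is low then in a fraction [delta] of the blocks the estimator is
   close to the true spike, whose position is then in the list. *)
Let low_loss_count J xy :
  delta * k%:R * \1_(low_loss J) xy <= \sum_b \1_(decoded b (J b)) xy.
Proof.
rewrite indicE; case: (boolP (xy \in low_loss J)) => [/set_mem gJ|_]; last first.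
  by rewrite mulr0 sumr_ge0.
rewrite mulr1.
have t0 : 0 < (1 - delta) * tau ^+ 2 by rewrite mulr_gt0// subr_gt0.
have := @count_markov R k
  (fun b => spike_dist tau (fun i => bh xy (idx b i) 0) (J b)) _ (1 - delta) t0.
rewrite subKr => /(_ (fun b => spike_dist_ge0 _ _ _)).
have loss : \sum_b spike_dist tau (fun i => bh xy (idx b i) 0) (J b) <=
    (1 - delta) * ((1 - delta) * tau ^+ 2) * k%:R.
  by rewrite mulrA -expr2; exact: (le_trans (spikes_loss idx idx_inj tau J (bh xy)) gJ).
move=> /(_ loss) /le_trans; apply; apply: ler_sum => b _.
by rewrite indicE; case: (boolP (_ < _)) => // h; rewrite mem_set.
Qed.

Let sum_decoded_le b (beta : 'cV[R]_p) : \sum_j pr (decoded b j) beta <= delta^-1.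
Proof.
apply: (sum_prob_le P (fun j => [set w | decoded b j (X w, X w *m beta + z w)])).
  by move=> j; exact: mset.
move=> w; have := near_spikes_card tau delta
  (fun i => bh (X w, X w *m beta + z w) (idx b i) 0) delta0.
apply: le_trans; apply: ler_sum => j _; rewrite indicE.
by case: (boolP (w \in _)) => // /set_mem; rewrite /decoded /= => ->.
Qed.

(** Averaging over all configurations.  In one block, [decoded_prob_le] reduces
    to the model without spike there, where the position is independent of the
    data, so that a list of at most [delta^-1] positions among [q] contains it
    with probability at most [delta^-1 / q]. *)
Lemma exists_hard_spikes : exists J : conf,
  pr (low_loss J) (spikes idx tau J) <=
  delta^-1 * (delta^-1 + 1) * expR (- (delta ^+ 2 * Lam / 32)).
Proof.
pose N : R := #|{: conf}|%:R.
have N0 : 0 < N by rewrite ltr0n card_ffun !card_ord expn_gt0 (ltnW q1).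
have qR0 : 0 < q%:R :> R by rewrite ltr0n (ltnW q1).
have kR0 : 0 < k%:R :> R by rewrite ltr0n.
pose e : R := expR ((1 - delta / 2) * Lam).
pose r : R := expR (- (delta ^+ 2 * Lam / 32)).
have eq : e / q%:R <= r.
  have -> : q%:R = expR Lam :> R by rewrite lnK// posrE.
  rewrite -expRN -expRD ler_expR.
  have h1 : 0 <= delta * Lam by exact: mulr_ge0 (ltW delta0) (ltW Lam0).
  have h2 : 0 <= delta * Lam * (1 - delta) by rewrite mulr_ge0// subr_ge0 ltW.
  lra.
have block b :
    \sum_(J : conf) pr (decoded b (J b)) (spikes idx tau J) <= N * (r * (delta^-1 + 1)).
  pose G (J : conf) j := pr (decoded b j) (base b J).
  have GE : \sum_(J : conf) G J (J b) <= N * delta^-1 / q%:R.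
    rewrite ler_pdivlMr// mulrC sum_resample => [|J i j].
      rewrite [N * _]mulr_natl -sumr_const; apply: ler_sum => J _; exact: sum_decoded_le.
    rewrite /G; congr (pr _ _); apply: eq_bigr => b' b'b.
    by rewrite ffunE (negbTE b'b).
  apply: (@le_trans _ _ (\sum_(J : conf) (e * G J (J b) + r))).
    by apply: ler_sum => J _; rewrite (spikes_base b); exact: decoded_prob_le.
  rewrite big_split/= -mulr_sumr sumr_const -mulr_natl -/N.
  have h1 : e * \sum_(J : conf) G J (J b) <= N * delta^-1 * r.
    apply: (le_trans (ler_wpM2l (expR_ge0 _) GE)).
    rewrite mulrCA; apply: ler_wpM2l => //.
    by apply: mulr_ge0; [exact: ltW|rewrite invr_ge0 ltW].
  have -> : N * (r * (delta^-1 + 1)) = N * delta^-1 * r + N * r by ring.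
  by rewrite lerD2r.
apply: contrapT => /forallNP h.
pose J0 : conf := [ffun=> Ordinal (ltnW q1)].
have : \sum_(J : conf) delta^-1 * (delta^-1 + 1) * r <
       \sum_(J : conf) pr (low_loss J) (spikes idx tau J).
  apply: ltr_sum => [|J _]; first by apply/hasP; exists J0; rewrite ?mem_index_enum.
  by rewrite ltNge; apply/negP; exact: h.
apply/negP; rewrite -leNgt.
have : \sum_(J : conf) delta * k%:R * pr (low_loss J) (spikes idx tau J) <=
   \sum_(J : conf) \sum_b pr (decoded b (J b)) (spikes idx tau J).
  apply: ler_sum => J _.
  apply: (prob_le_sum P (fun b =>
    [set w | decoded b (J b) (X w, X w *m spikes idx tau J + z w)])).
  - by move=> b; exact: mset.
  - exact: mset.
  - by rewrite mulr_ge0// ltW.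
  - by move=> w; exact: low_loss_count.
rewrite exchange_big /= -mulr_sumr => H.
have {}H : delta * k%:R * \sum_(J : conf) pr (low_loss J) (spikes idx tau J) <=
    \sum_(b < k) N * (r * (delta^-1 + 1)).
  by apply: (le_trans H); apply: ler_sum => b _; exact: block.
have sumJ (a : R) : \sum_(J : conf) a = N * a by rewrite sumr_const mulr_natl.
have sumb (a : R) : \sum_(b < k) a = k%:R * a by rewrite sumr_const card_ord mulr_natl.
rewrite sumb in H; rewrite sumJ.
have dk0 : 0 < delta * k%:R by rewrite mulr_gt0.
rewrite -(ler_pM2l dk0); apply: (le_trans H).
rewrite le_eqVlt; apply/orP; left; apply/eqP.
by field; rewrite gt_eqF.
Qed.
End bayes.

Section finite_sample.
Context {d} {T : measurableType d} {R : realType} {n p k q : nat}.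
Variables (P : probability T R) (sigma : R).
Variables (X : {RV P >-> 'M[R]_(n, p)}) (z : {RV P >-> 'cV[R]_n}).
Hypotheses (sigma0 : 0 < sigma) (n0 : (0 < n)%N).
Hypothesis iidX : iid P (fun (ij : 'I_n * 'I_p) w => X w ij.1 ij.2)
                    (normal_prob 0 (Num.sqrt n%:R)^-1).
Hypothesis iidz : iid P (fun (i : 'I_n) w => z w i 0) (normal_prob 0 sigma).
Hypothesis indXz : independent2 P X z.

(** The non-asymptotic form of the theorem; the blocks are consecutive intervals
    of length [q]. *)
Lemma minimax_lower_bound (delta : R)
    (bh : {mfun ('M[R]_(n, p) * 'cV[R]_n)%type >-> 'cV[R]_p}) :
  (0 < k)%N -> (1 < q)%N -> (k * q <= p)%N -> 0 < delta -> delta < 1 ->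
  4 * ln q%:R / n%:R <= delta / 8 ->
  exists2 beta : 'cV[R]_p, (l0norm beta <= k)%N &
   ((1 - delta^-1 * (delta^-1 + 1) * expR (- (delta ^+ 2 * ln q%:R / 32))%R)%:E <=
    P [set w | ((1 - delta) ^+ 3 * (2 * sigma ^+ 2 * k%:R * ln q%:R) <
      l2norm (bh (X w, X w *m beta + z w) - beta) ^+ 2)%R])%E.
Proof.
move=> k0 q1 kqp d0 d1 Ln.
pose idx (b : 'I_k) (i : 'I_q) : 'I_p := widen_ord kqp (mxvec_index b i).
have idx_inj : injective (fun bi : 'I_k * 'I_q => idx bi.1 bi.2).
  move=> [b i] [b' i'] /= /(congr1 val) /= E.
  by have [-> ->] := enum_rank_inj (val_inj E).
have [J] := exists_hard_spikes P sigma X z sigma0 n0 iidX iidz indXz bh idx idx_inj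
  k0 q1 delta d0 d1 Ln.
set beta := spikes idx _ J; set D := [set w | _] => hD.
exists beta; first exact: l0norm_spikes.
have mD : measurable D.
  have := measurable_loss P X z bh beta measurableT _ (measurable_itv `]-oo,
    (1 - delta) ^+ 2 * Num.sqrt ((1 - delta) * 2 * sigma ^+ 2 * ln q%:R) ^+ 2 * k%:R]).
  rewrite setTI; congr measurable; apply/seteqP.
  by split => w; rewrite /D /= in_itv/= l2norm_sqr.
have tau2 : Num.sqrt ((1 - delta) * 2 * sigma ^+ 2 * ln q%:R) ^+ 2 =
    (1 - delta) * 2 * sigma ^+ 2 * ln q%:R.
  rewrite sqr_sqrtr//; apply: mulr_ge0; last by rewrite ln_ge0// ler1n ltnW.
  apply: mulr_ge0; last exact: sqr_ge0.
  by apply: mulr_ge0 => //; rewrite subr_ge0 ltW.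
have thrE : (1 - delta) ^+ 3 * (2 * sigma ^+ 2 * k%:R * ln q%:R) =
  (1 - delta) ^+ 2 * ((1 - delta) * 2 * sigma ^+ 2 * ln q%:R) * k%:R by ring.
rewrite (_ : [set w | _] = ~` D).
  rewrite probability_setC// -[P D]fineK ?fin_num_measure// -EFinB lee_fin.
  by rewrite lerD2l lerN2.
apply/seteqP; split => w /=; rewrite /D /= l2norm_sqr tau2 thrE.
  by rewrite ltNge => /negP.
by move=> /negP; rewrite -ltNge.
Qed.
End finite_sample.

(** * The asymptotic statement *)

Section asymptotics.
Context {R : realType}.

(** Rounding [p / k] down to an integer costs at most a factor [2], which is
    negligible on the logarithmic scale. *)
Lemma ln_ratio_divn (k p : nat) (delta : R) : (0 < k)%N -> (1 < p %/ k)%N ->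
  0 < delta -> ln 2 <= delta * ln (p %/ k)%:R ->
  0 < ln (p%:R / k%:R : R) /\ (1 - delta) * ln (p%:R / k%:R) <= ln (p %/ k)%:R.
Proof.
move=> k0 q1 d0 ln2; set q := (p %/ k)%N.
have kR0 : 0 < k%:R :> R by rewrite ltr0n.
have qR0 : 0 < q%:R :> R by rewrite ltr0n (ltnW q1).
have qle : q%:R <= p%:R / k%:R :> R.
  by rewrite ler_pdivlMr// -natrM ler_nat leq_trunc_div.
have ple : p%:R / k%:R <= 2 * q%:R :> R.
  rewrite ler_pdivrMr// -!natrM ler_nat.
  apply: (leq_trans (ltnW (ltn_ceil p k0))).
  by rewrite leq_mul2r -/q mul2n -addnn -addn1 leq_add2l (ltnW q1) orbT.
have r1 : 1 < p%:R / k%:R :> R by apply: lt_le_trans qle; rewrite ltr1n.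
have r0 : 0 < p%:R / k%:R :> R by apply: lt_trans r1.
have L0 : 0 < ln (p%:R / k%:R : R) by exact: ln_gt0.
split=> //.
have : ln (p%:R / k%:R) <= ln 2 + ln q%:R :> R.
  by rewrite -lnM ?posrE// ler_ln ?posrE// mulr_gt0.
have Lq0 : 0 <= ln q%:R :> R by rewrite ln_ge0// ler1n ltnW.
have := mulr_ge0 (ltW d0) (ltW L0).
have : delta * ln q%:R <= delta * ln (p%:R / k%:R).
  by rewrite ler_pM2l// ler_ln ?posrE.
lra.
Qed.

Lemma exp_decay (C a e : R) : 0 < C -> 0 < a -> 0 < e ->
  exists2 K, 0 < K & forall x, K <= x -> C * expR (- (a * x)) <= e.
Proof.
move=> C0 a0 e0; exists (C / e / a); first by rewrite !divr_gt0.
move=> x Kx; rewrite expRN ler_pdivrMr ?expR_gt0//.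
apply: (@le_trans _ _ (e * (1 + a * x))); last by rewrite ler_pM2l// expR_ge1Dx.
have : C <= e * (a * x).
  by rewrite mulrC -ler_pdivrMr// -ler_pdivrMl// mulrC.
by move: e0; lra.
Qed.
End asymptotics.

Theorem theorem1p3 (R : realType) (sigma : R) (hsigma : 0 < sigma)
  (k n p : nat -> nat)
  (hk : forall m, (0 < k m)%N) (hn : forall m, (0 < n m)%N)
  (hp : forall m, (0 < p m)%N)
  (hp_oo : p m @[m --> \oo] --> \oo)
  (hkp : (k m)%:R / (p m)%:R @[m --> \oo] --> (0 : R))
  (hkpn : (k m)%:R * ln (p m)%:R / (n m)%:R @[m --> \oo] --> (0 : R))
  (d : nat -> measure_display) (T : forall m, measurableType (d m))
  (P : forall m, probability (T m) R)
  (X : forall m, {RV (P m) >-> 'M[R]_(n m, p m)})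
  (z : forall m, {RV (P m) >-> 'cV[R]_(n m)})
  (hX : forall m, iid (P m) (fun (ij : 'I_(n m) * 'I_(p m)) w => X m w ij.1 ij.2)
                    (normal_prob 0 (Num.sqrt (n m)%:R)^-1))
  (hz : forall m, iid (P m) (fun (i : 'I_(n m)) w => z m w i 0)
                    (normal_prob 0 sigma))
  (hXz : forall m, independent2 (P m) (X m) (z m))
  (eps : R) (heps : 0 < eps) :
  ereal_inf
    [set ereal_sup
      [set P m [set w |
            l2norm (betahat (X m w, X m w *m beta + z m w) - beta) ^+ 2
            / (2 * sigma ^+ 2 * (k m)%:R * ln ((p m)%:R / (k m)%:R))
            > 1 - eps]
      | beta in [set beta : 'cV[R]_(p m) | (l0norm beta <= k m)%N]]
    | betahat in [set: {mfun ('M[R]_(n m, p m) * 'cV[R]_(n m))%type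
                          >-> 'cV[R]_(p m)}]]
  @[m --> \oo] --> (1%E : \bar R).
Proof.
set F := fun m => ereal_inf _.
pose loss m (bh : {mfun ('M[R]_(n m, p m) * 'cV[R]_(n m))%type >-> 'cV[R]_(p m)}) beta :=
  [set w | l2norm (bh (X m w, X m w *m beta + z m w) - beta) ^+ 2
            / (2 * sigma ^+ 2 * (k m)%:R * ln ((p m)%:R / (k m)%:R)) > 1 - eps].
have mgt m (f : T m -> R) c : measurable_fun setT f -> measurable [set w | c < f w].
  move=> mf; have := mf measurableT _ (measurable_itv `]c, +oo[).
  by rewrite setTI; congr measurable; apply/seteqP; split => w; rewrite /= in_itv/= andbT.
have mloss m bh beta : measurable (loss m bh beta).
  by apply: mgt; apply: measurable_funM => //; exact: measurable_loss.
have F1 m : (F m <= 1)%E.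
  apply: ge_ereal_inf; exists (ereal_sup [set P m (loss m (cst 0) beta) | beta in
     [set beta : 'cV[R]_(p m) | (l0norm beta <= k m)%N]]).
    by exists (cst 0).
  by apply: ge_ereal_sup => _ [beta _ <-]; exact: probability_le1.
(* The factors [1 - delta] lost in the height of the spikes, in the definition
   of the lists, in the fraction of decoded blocks and in the rounding of
   [p / k] make up [(1 - delta) ^+ 4], which is at least [1 - eps] for
   [delta = eps / 4].  The minimum with [1 / 2] keeps [delta] below one. *)
have lower e : 0 < e -> \forall m \near \oo, ((1 - e)%:E <= F m)%E.
  move=> e0; pose eps' := Num.min eps (1 / 2); pose delta := eps' / 4.
  have eps'0 : 0 < eps' by rewrite lt_min heps divr_gt0.
  have eps'1 : eps' <= 1 / 2 by rewrite ge_min lexx orbT.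
  have eps'e : eps' <= eps by rewrite ge_min lexx.
  have d0 : 0 < delta by rewrite divr_gt0.
  have d1 : delta < 1 by rewrite /delta; lra.
  have C0 : 0 < delta^-1 * (delta^-1 + 1) by rewrite mulr_gt0 ?addr_gt0 ?invr_gt0.
  have a0 : 0 < delta ^+ 2 / 32 by rewrite divr_gt0// exprn_gt0.
  have [K K0 HK] := exp_decay _ _ _ C0 a0 e0.
  (* Beyond [K'], the logarithm of [q] makes the error at most [e], absorbs the
     rounding of [p / k], and forces [1 < q]. *)
  pose K' := Num.max K (Num.max (ln 2 / delta) 1).
  have eta0 : 0 < (expR K' + 1)^-1 by rewrite invr_gt0 addr_gt0 ?expR_gt0.
  have near_kp : \forall m \near \oo, (k m)%:R / (p m)%:R < (expR K' + 1)^-1.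
    have /cvgrPdist_lt /(_ _ eta0) := hkp; apply: filterS => m.
    by rewrite sub0r normrN; exact: le_lt_trans (ler_norm _).
  have d32 : 0 < delta / 32 by rewrite divr_gt0.
  have near_kpn : \forall m \near \oo, (k m)%:R * ln (p m)%:R / (n m)%:R < delta / 32.
    have /cvgrPdist_lt /(_ _ d32) := hkpn; apply: filterS => m.
    by rewrite sub0r normrN; exact: le_lt_trans (ler_norm _).
  near=> m.
  have kR0 : 0 < (k m)%:R :> R by rewrite ltr0n.
  have nR0 : 0 < (n m)%:R :> R by rewrite ltr0n.
  have pR0 : 0 < (p m)%:R :> R by rewrite ltr0n.
  set q := (p m %/ k m)%N.
  have ratio : (k m)%:R / (p m)%:R < (expR K' + 1)^-1.
    by near: m; exact: near_kp.
  have klogp : (k m)%:R * ln (p m)%:R / (n m)%:R < delta / 32.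
    by near: m; exact: near_kpn.
  have qK : expR K' < q%:R.
    have : expR K' + 1 < (p m)%:R / (k m)%:R.
      by rewrite -[ltLHS]invrK -[ltRHS]invf_div ltf_pV2// posrE ?addr_gt0 ?expR_gt0 ?divr_gt0.
    have : (p m)%:R / (k m)%:R < q%:R + 1 :> R.
      by rewrite ltr_pdivrMr// natr1 -natrM ltr_nat ltn_ceil.
    lra.
  have q1 : (1 < q)%N.
    rewrite -(ltr_nat R); apply: lt_trans qK.
    by rewrite -expR0 ltr_expR !lt_max ltr01 !orbT.
  have qR0 : 0 < q%:R :> R by rewrite ltr0n ltnW.
  have LK' : K' <= ln q%:R by rewrite -ler_expR lnK ?posrE// ltW.
  have LK : K <= ln q%:R by apply: le_trans LK'; rewrite le_max lexx.
  have ln2 : ln 2 <= delta * ln q%:R.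
    by rewrite mulrC -ler_pdivrMr//; apply: le_trans LK'; rewrite !le_max lexx orbT.
  have Lq0 : 0 < ln q%:R :> R by exact: lt_le_trans LK.
  have Ln : 4 * ln q%:R / (n m)%:R <= delta / 8.
    have : ln q%:R / (n m)%:R <= (k m)%:R * ln (p m)%:R / (n m)%:R :> R.
      rewrite ler_pM2r ?invr_gt0// -[leLHS]mul1r ler_pM ?(ltW Lq0)// ?ler1n//.
      by rewrite ler_ln ?posrE// ler_nat leq_div.
    lra.
  have kqp : (k m * q <= p m)%N by rewrite mulnC leq_trunc_div.
  apply: le_ereal_inf_tmp => _ [bh _ <-].
  have [beta bk hP] := minimax_lower_bound (P m) sigma (X m) (z m) hsigma (hn m)
    (hX m) (hz m) (hXz m) delta bh (hk m) q1 kqp d0 d1 Ln.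
  apply: (@le_trans _ _ (P m (loss m bh beta))); last first.
    by apply: ereal_sup_ubound; exists beta.
  apply: (@le_trans _ _ (1 - delta^-1 * (delta^-1 + 1) *
      expR (- (delta ^+ 2 * ln q%:R / 32)))%:E).
    rewrite lee_fin lerD2l lerN2 [delta ^+ 2 * _ / _]mulrAC; exact: HK.
  apply: (le_trans hP); apply: le_measure; rewrite ?inE//.
    by apply: mgt; exact: measurable_loss.
  move=> w; rewrite /loss /=.
  have [L0 Lle] := ln_ratio_divn _ _ _ (hk m) q1 d0 ln2.
  set L := ln ((p m)%:R / (k m)%:R) in L0 Lle *.
  have den0 : 0 < 2 * sigma ^+ 2 * (k m)%:R * L.
    by rewrite !mulr_gt0// exprn_gt0.
  rewrite ltr_pdivlMr//; apply: le_lt_trans.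
  apply: (@le_trans _ _ ((1 - delta) ^+ 4 * (2 * sigma ^+ 2 * (k m)%:R * L))).
    rewrite ler_pM2r//.
    have epsE : eps' = 4 * delta by rewrite /delta; field.
    have := mulr_ge0 (sqr_ge0 delta) (sqr_ge0 (delta - 2)).
    have := sqr_ge0 delta; move: eps'e; rewrite epsE; lra.
  rewrite exprSr -mulrA ler_wpM2l//; first by rewrite exprn_ge0// subr_ge0 ltW.
  by rewrite mulrCA ler_wpM2l// !mulr_ge0// ?ltW// exprn_gt0.
have F0 : \forall m \near \oo, (0 <= F m)%E.
  by have := lower 1 ltr01; rewrite subrr.
apply/fine_cvgP; split.
  apply: filterS F0 => m Fm0; rewrite ge0_fin_numE//.
  by apply: le_lt_trans (F1 m) _; rewrite ltry.
apply/cvgrPdist_le => e e0; near=> m.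
have Fm0 : (0 <= F m)%E by near: m.
have Fm : ((1 - e)%:E <= F m)%E by near: m; exact: lower.
have Ffin : F m \is a fin_num.
  by rewrite ge0_fin_numE//; apply: le_lt_trans (F1 m) _; rewrite ltry.
have Fm1 := F1 m; rewrite -(fineK Ffin) !lee_fin in Fm Fm1.
by rewrite /= ger0_norm ?subr_ge0//; lra.
Unshelve. all: by end_near.
Qed.
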